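(* For every $n\in\mathbb{N}$ let $Z_n$ be a real-valued random variable with $\mathbb{E}Z_n=0$, variance $\mathbb{V}(Z_n)=1$ and $\mathbb{E}|Z_n|^j<\infty$ for all $j\in\mathbb{N}$. Let $\gamma\ge0$ be fixed, and suppose that there are constants $\widetilde C_j$ ($j\ge3$), not depending on $n$, and numbers $\Delta_n>0$ such that for all $n$ $$|\Gamma_j(Z_n)|\le\frac{(j!)^{1+\gamma}\,\widetilde C_j}{\Delta_n^{j-2}}\qquad\text{for all }j=3,4,\dots.$$ Put $\widetilde C_2:=1$ and let $N$ be a standard normally distributed random variable. Then for every integer $k\ge3$ and every $n\in\mathbb{N}$, $$\bigl|\mathbb{E}(Z_n^k)-\mathbb{E}(N^k)\bigr|\le (k!)^{1+\gamma}\sum_{1\le j\le\lceil\frac k2-1\rceil}\widetilde A_{j,k}\,\frac1{\Delta_n^{k-2j}},\qquad \widetilde A_{j,k}:=\frac1{j!}\sum_{\substack{k_1+\cdots+k_j=k\\k_i\ge2}}\widetilde C_{k_1}\cdots\widetilde C_{k_j}\,\frac{k!}{k_1!\cdots k_j!},$$ where the inner sum runs over $j$-tuples of integers $k_i\ge2$ with sum $k$.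
   Context: For a real-valued random variable $X$ with finite absolute moments of all orders, the $j$-th cumulant is $\Gamma_j(X):=(-i)^j\frac{d^j}{dt^j}\log\mathbb{E}[e^{itX}]\big|_{t=0}$. $\lceil\cdot\rceil$ is the ceiling function. *)

(* Defs.v *)
From HB Require Import structures.
From mathcomp Require Import all_boot all_order all_algebra.
From mathcomp Require Import complex.
From mathcomp Require Import all_classical all_reals all_analysis.

Set Implicit Arguments.
Unset Strict Implicit.
Unset Printing Implicit Defensive.

Import Order.TTheory GRing.Theory Num.Theory.
Import numFieldNormedType.Exports.

Local Open Scope classical_set_scope.
Local Open Scope ring_scope.
Local Open Scope complex_scope.

Section complex_functions.
Context {R : realType}.
Implicit Types (t : R) (z : R[i]).

(* exp (i t) *)
Definition expi t : R[i] := cos t +i* sin t.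

(* The norm of R[i] takes values in R[i]; this is the same norm as a real. *)
Definition cmod z : R := complex.Re `|z|.

(* Principal argument, in ]-pi, pi] (see cargP); carg 0 is irrelevant. *)
Definition carg z : R :=
  let a := acos (complex.Re z / cmod z) in
  if 0 <= complex.Im z then a else - a.

(* Principal branch of the logarithm. *)
Definition clog z : R[i] := ln (cmod z) +i* carg z.

(* The n-th derivative, taken componentwise: the library has no normed R-module
   structure on R[i]. *)
Definition cderive1n (n : nat) (f : R -> R[i]) t : R[i] :=
  derive1n n (fun s => complex.Re (f s)) t +i*
  derive1n n (fun s => complex.Im (f s)) t.

Lemma cargP z : z != 0 ->
  - pi < carg z <= pi /\ z = (cmod z)%:C * expi (carg z).
Proof.
case: z => a b; rewrite eq_complex /= negb_and => z0.
rewrite /carg /cmod normc_def /=.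
set m := Num.sqrt _.
have m2 : m ^+ 2 = a ^+ 2 + b ^+ 2 by rewrite sqr_sqrtr // addr_ge0 ?sqr_ge0.
have m0 : 0 < m.
  rewrite sqrtr_gt0 lt_def addr_ge0 ?sqr_ge0 // andbT paddr_eq0 ?sqr_ge0 //.
  by rewrite !sqrf_eq0 negb_and.
have mN0 : m != 0 by rewrite gt_eqF.
have am2 : (a / m) ^+ 2 + (b / m) ^+ 2 = 1.
  by rewrite !expr_div_n -mulrDl -m2 divff // expf_neq0.
have am : -1 <= a / m <= 1.
  rewrite -ler_norml -(@ler_pXn2r _ 2) ?nnegrE //.
  by rewrite -normrX expr1n ger0_norm ?sqr_ge0 // -am2 lerDl sqr_ge0.
have cosE : m * cos (acos (a / m)) = a by rewrite acosK // mulrCA divff ?mulr1.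
have sinE : m * sin (acos (a / m)) = `|b|.
  rewrite sin_acos // -am2 addrC addKr sqrtr_sqr normrM normfV (gtr0_norm m0).
  by rewrite mulrCA divff ?mulr1.
have a0 := acos_ge0 am; have api := acos_lepi am.
have pi0 := pi_gt0 R.
case: ifPn => b0.
  split; first by rewrite api andbT (lt_le_trans _ a0) // oppr_lt0.
  rewrite /expi; simpc.
  by rewrite cosE sinE ger0_norm.
rewrite -ltNge in b0; split.
  rewrite ltrN2 (le_trans _ (ltW pi0)) ?oppr_le0 // andbT.
  apply: acos_ltpi; rewrite andbC; case/andP: am => am1 ->; rewrite /= lt_neqAle am1 andbT.
  apply/eqP => a1; move: am2; rewrite -a1 sqrrN expr1n => /eqP.
  rewrite -subr_eq0 addrAC subrr add0r sqrf_eq0 mulf_eq0 invr_eq0 (negbTE mN0) orbF.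
  by rewrite lt_eqF.
rewrite /expi cosN sinN; simpc.
by rewrite cosE sinE ltr0_norm // opprK.
Qed.

End complex_functions.

Section cumulants.
Context d (T : measurableType d) {R : realType} (P : probability T R).

(* `fine` is harmless on charfun below: cos and sin are bounded. *)
Definition cexpectation (f : T -> R[i]) : R[i] :=
  fine 'E_P[fun w => complex.Re (f w)] +i* fine 'E_P[fun w => complex.Im (f w)].

Definition charfun (X : T -> R) (t : R) : R[i] :=
  cexpectation (fun w => expi (t * X w)).

Definition cumulant (j : nat) (X : T -> R) : R[i] :=
  (- 'i%C) ^+ j * cderive1n j (fun t => clog (charfun X t)) 0.

End cumulants.

(* Sum over the j-tuples of integers k_i >= 2 with sum k; such k_i are at most
   k, whence the finite index type. *)
Definition Atilde {R : realType} (C : nat -> R) (j k : nat) : R :=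
  (j`!%:R)^-1 *
  \sum_(s : {ffun 'I_j -> 'I_k.+1} |
        [forall i, (2 <= s i)%N] && ((\sum_(i < j) s i)%N == k))
    (\prod_(i < j) C (s i)) * (k`!%:R / \prod_(i < j) ((s i)`!)%:R).

(* Main.v *)
(* The characteristic function f of Z satisfies f' = f (log f)' near 0, so
   Leibniz' rule yields m_(n+1) = sum_i C(n,i) m_i c_(n+1-i) for the moments m
   and cumulants c of Z.  Solving this recursion,
   m_k = sum_j 1/j! sum_(k_1+...+k_j=k) k!/(k_1!...k_j!) c_(k_1)...c_(k_j),
   with all k_i >= 2 because c_1 = 0.  By Stein's identity the moments of N obey
   the same recursion with c_2 = 1 and all other c_j = 0.  The terms with
   2j >= k coincide for Z and N, since then every k_i is 2 and c_2 = 1; those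
   with 2j < k vanish for N, and for Z they are bounded using
   k_1!...k_j! <= k! and sum_i (k_i - 2) = k - 2j. *)

Require Import Defs.
From HB Require Import structures.
From mathcomp Require Import all_boot all_order all_algebra.
From mathcomp Require Import complex.
From mathcomp Require Import all_classical all_reals all_analysis.
From mathcomp Require Import measurable_realfun lebesgue_integral_under zify ring lra.

Set Implicit Arguments.
Unset Strict Implicit.
Unset Printing Implicit Defensive.

Import Order.TTheory GRing.Theory Num.Theory.
Import numFieldNormedType.Exports.

Local Open Scope classical_set_scope.
Local Open Scope ring_scope.

(** * Moments in terms of cumulants *)

Section moments_from_cumulants.
Variable F : numFieldType.
Implicit Types (a m c : nat -> F).

(** Distributivity yields one monomial per tuple; truncating at degree [k] makes the tuples range
    over the same finite type as in [Atilde]. *)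
Lemma coef_poly_expr a j k :
  ((\poly_(i < k.+1) a i) ^+ j)`_k =
  \sum_(s : {ffun 'I_j -> 'I_k.+1} | (\sum_(i < j) s i == k)%N)
    \prod_(i < j) a (s i).
Proof.
rewrite poly_def -[X in _ ^+ X]card_ord -prodr_const bigA_distr_bigA /=.
rewrite coef_sum [RHS]big_mkcond /=; apply: eq_bigr => s _.
have -> : \prod_(i < j) (a (s i) *: 'X^(s i)) =
    (\prod_(i < j) a (s i)) *: 'X^(\sum_(i < j) s i) :> {poly F}.
  by rewrite scaler_prod prodrXr.
by rewrite coefZ coefXn eq_sym; case: eqP => _; rewrite ?mulr1 ?mulr0.
Qed.

(** Without constant term [p] is divisible by 'X, hence [p ^+ K] by 'X^K. *)
Lemma coef_low_expr (p : {poly F}) K n : p`_0 = 0 -> (n < K)%N -> (p ^+ K)`_n = 0.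
Proof.
move=> p0; elim: K n => [//|K IH] n nK; rewrite exprS coefM big1// => -[i /= ile] _.
case: i ile => [|i] ile; first by rewrite p0 mul0r.
by rewrite IH ?mulr0//; lia.
Qed.

(* The partial sum E of exp p satisfies E' = p' (E - p^K / K!), so its
   coefficients obey, below degree K, the recursion of the formal exponential. *)
Lemma coef_exp_rec (p : {poly F}) K n : p`_0 = 0 -> (n < K)%N ->
  let E := \sum_(j < K.+1) j`!%:R^-1 *: p ^+ j in
  n.+1%:R * E`_n.+1 = \sum_(i < n.+1) (n.+1 - i)%:R * p`_(n.+1 - i) * E`_i.
Proof.
move=> p0 nK E; pose E' := \sum_(j < K) j`!%:R^-1 *: p ^+ j.
have dE : deriv E = deriv p * E'.
  rewrite /E linear_sum big_ord_recl /= derivZ expr0 derivC scaler0 add0r.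
  rewrite mulr_sumr; apply: eq_bigr => j _.
  rewrite derivZ deriv_exp -[X in _ *: X = _]scaler_nat scalerA -scalerAr; congr (_ *: _).
  by rewrite factS natrM invfM mulrAC mulVf ?mul1r// pnatr_eq0.
rewrite mulr_natl -coef_deriv dE coefMr; apply: eq_bigr => -[i /= ile] _.
rewrite coef_deriv subSn// mulr_natl; congr (_ * _).
by rewrite /E big_ord_recr /= coefD coefZ coef_low_expr ?mulr0 ?addr0// (leq_trans ile).
Qed.

Definition cumulant_sum c (j k : nat) : F :=
  j`!%:R^-1 *
  \sum_(s : {ffun 'I_j -> 'I_k.+1} |
        [forall i, (2 <= s i)%N] && (\sum_(i < j) s i == k)%N)
    (\prod_(i < j) c (s i)) * (k`!%:R / \prod_(i < j) (s i)`!%:R).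

(** For the exponential generating functions M of [m] and p of [c], the recursion reads M' = p' M,
    whence M = exp p. *)
Lemma moment_cumulantE m c : m 0 = 1 -> c 1%N = 0 ->
  (forall n, m n.+1 = \sum_(i < n.+1) 'C(n, i)%:R * m i * c (n.+1 - i)%N) ->
  forall k, m k = \sum_(j < k.+1) cumulant_sum c j k.
Proof.
move=> m0 c1 mS k.
(* Cutting off the indices 0 and 1 encodes k_i >= 2 and gives [p] no constant term; at index 1
   nothing is lost because [c 1] is 0. *)
pose a i := if (2 <= i)%N then c i / i`!%:R else 0.
pose p := \poly_(i < k.+1) a i.
pose E := \sum_(j < k.+1) j`!%:R^-1 *: p ^+ j.
have p0 : p`_0 = 0 by rewrite coef_poly.
have pE i : (0 < i <= k)%N -> i%:R * p`_i = c i / i.-1`!%:R.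
  case: i => // i /= ik; rewrite coef_poly ltnS ik /a.
  case: i ik => [|i] ik /=; first by rewrite c1 mul0r mulr0.
  rewrite mulrCA factS natrM invfM [i.+2%:R * _]mulrA mulfV ?mul1r// pnatr_eq0//.
(* Both sides satisfy the same recursion up to degree [k], the range in which the truncated
   exponential [E] is exact. *)
have mE n : (n <= k)%N -> E`_n = m n / n`!%:R.
  elim/ltn_ind: n => -[|n] IH nk.
    rewrite m0 /E coef_sum big_ord_recl expr0 fact0 coefZ coef1 big1 => [|i _].
      by rewrite addr0 invr1 eqxx mulr1.
    by rewrite coefZ coef_low_expr// mulr0.
  have := coef_exp_rec p0 nk; rewrite -/E /= => EE.
  apply: (@mulfI _ n.+1%:R); first by rewrite pnatr_eq0.
  transitivity (m n.+1 / n`!%:R); last first.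
    by rewrite factS natrM invfM [RHS]mulrCA mulVKf ?pnatr_eq0.
  rewrite EE mS mulr_suml; apply: eq_bigr => -[i /= ile] _.
  rewrite pE; last by lia.
  rewrite IH; [|by []|by lia].
  rewrite -(bin_fact (n:=n) (m:=i))//.
  have -> : (n.+1 - i).-1 = (n - i)%N by rewrite subSn.
  rewrite !natrM.
  set B := 'C(n, i)%:R; set f1 := i`!%:R; set f2 := (n - i)`!%:R.
  have B0 : B != 0 by rewrite /B pnatr_eq0 -lt0n bin_gt0 -ltnS.
  have f10 : f1 != 0 by rewrite /f1 pnatr_eq0 -lt0n fact_gt0.
  have f20 : f2 != 0 by rewrite /f2 pnatr_eq0 -lt0n fact_gt0.
  by field; rewrite B0 f10 f20.
have kf : k`!%:R != 0 :> F by rewrite pnatr_eq0 -lt0n fact_gt0.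
have -> : m k = k`!%:R * E`_k by rewrite mE// mulrCA mulfV// mulr1.
rewrite coef_sum mulr_sumr; apply: eq_bigr => j _.
rewrite coefZ mulrCA /cumulant_sum; congr (_ * _).
rewrite coef_poly_expr mulr_sumr big_mkcond [RHS]big_mkcond /=.
apply: eq_bigr => s _; case: (_ == k); rewrite ?andbF// andbT.
case: ifPn => [/forallP s2|].
  rewrite [RHS]mulrCA; congr (_ * _); rewrite -prodf_div; apply: eq_bigr => i _.
  by rewrite /a s2.
rewrite negb_forall => /existsP [i si]; rewrite -ltnNge in si.
by rewrite (bigD1 i)//= /a leqNgt si mul0r mulr0.
Qed.

End moments_from_cumulants.

(** * Estimates for the terms of the moment expansion *)

(** The quotient is a multinomial coefficient, a positive integer, built up one binomial coefficient
    at a time. *)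
Lemma prod_fact_le (I : Type) (r : seq I) (s : I -> nat) :
  (\prod_(i <- r) (s i)`! <= (\sum_(i <- r) s i)`!)%N.
Proof.
elim/big_rec2: _ => [//|i m n _ mn].
apply: (leq_trans (leq_mul (leqnn _) mn)).
by rewrite -(@bin_fact (s i + m) (s i)) ?leq_addr// addKn leq_pmull// bin_gt0 leq_addr.
Qed.

Lemma powR_prodr (R : realType) (I : Type) (r : seq I) (s : I -> R) (e : R) :
  (forall i, 0 <= s i) ->
  \prod_(i <- r) s i `^ e = (\prod_(i <- r) s i) `^ e.
Proof.
move=> s0; elim: r => [|i r IH]; first by rewrite !big_nil powR1.
by rewrite !big_cons powRM ?IH// prodr_ge0.
Qed.

Lemma sum_subn2 j (s : 'I_j -> nat) : (forall i, 2 <= s i)%N ->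
  (\sum_(i < j) (s i - 2) = \sum_(i < j) s i - 2 * j)%N.
Proof. by move=> s2; rewrite sumnB// sum_nat_const card_ord mulnC. Qed.

Lemma norm_cumulant_sum_le (R : realType) (c : nat -> R[i]) (gamma : R)
    (C : nat -> R) (D : R) j k :
  0 <= gamma -> 0 < D -> C 2 = 1 -> c 2 = 1 ->
  (forall i, (3 <= i)%N ->
     `|c i| <= ((i`!%:R `^ (1 + gamma) * C i) / D ^+ (i - 2))%:C%C) ->
  `|cumulant_sum c j k| <=
    (k`!%:R `^ (1 + gamma) * (Atilde C j k * (1 / D ^+ (k - 2 * j))))%:C%C.
Proof.
move=> g0 D0 C2 c2 cle.
have f0 i : 0 <= i`!%:R :> R by rewrite ler0n.
have f1 i : 1 <= i`!%:R :> R by rewrite ler1n fact_gt0.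
have p0 i : 0 < i`!%:R `^ (1 + gamma) by rewrite powR_gt0// ltr0n fact_gt0.
have e0 : 0 <= 1 + gamma by rewrite addr_ge0.
(* The bound is extended to index 2, where it reads 1 <= 2!^(1 + gamma), so that all parts of a
   tuple are treated alike. *)
pose b i := (i`!%:R `^ (1 + gamma) * C i) / D ^+ (i - 2).
have cb i : (2 <= i)%N -> `|c i| <= (b i)%:C%C.
  rewrite leq_eqVlt => /orP[/eqP <-|]; last exact: cle.
  rewrite c2 normr1 /b C2 mulr1 subnn expr0 divr1 -(rmorph1 (@real_complex R)) lecR.
  by apply: (le_trans (f1 2)); apply: le1r_powR; rewrite ?f1// lerDl.
(* Nonnegativity is forced by the bound: a positive multiple of [C i] dominates a norm. *)
have C0 i : (2 <= i)%N -> 0 <= C i.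
  move=> i2; have : 0 <= b i by rewrite -ler0c (le_trans _ (cb i i2)).
  by rewrite /b pmulr_lge0 ?invr_gt0 ?exprn_gt0// pmulr_rge0.
rewrite /cumulant_sum /Atilde normrM.
rewrite (ger0_norm (_ : 0 <= j`!%:R^-1)) ?invr_ge0 ?ler0n//.
rewrite -mulrA mulrCA rmorphM /= fmorphV rmorph_nat ler_wpM2l ?invr_ge0 ?ler0n//.
rewrite mulr_suml mulr_sumr rmorph_sum /=; apply: le_trans (ler_norm_sum _ _ _) _.
apply: ler_sum => s /andP[/forallP s2 /eqP sk].
rewrite normrM [X in _ * X]ger0_norm ?divr_ge0 ?ler0n//; last first.
  by rewrite prodr_ge0// => i _; rewrite ler0n.
rewrite normr_prod.
have -> : (k`!%:R / \prod_(i < j) (s i)`!%:R : R[i]) =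
    (k`!%:R / \prod_(i < j) (s i)`!%:R)%:C%C.
  rewrite fmorph_div rmorph_nat rmorph_prod.
  by under [in RHS]eq_bigr do rewrite rmorph_nat.
have -> : k`!%:R `^ (1 + gamma) * (\prod_(i < j) C (s i) *
    (k`!%:R / \prod_(i < j) (s i)`!%:R) * (1 / D ^+ (k - 2 * j))) =
  (k`!%:R `^ (1 + gamma) * \prod_(i < j) C (s i) / D ^+ (k - 2 * j)) *
  (k`!%:R / \prod_(i < j) (s i)`!%:R).
  by ring.
rewrite [leRHS]rmorphM ler_wpM2r//.
  by rewrite ler0c divr_ge0// prodr_ge0.
apply: (@le_trans _ _ (\prod_(i < j) (b (s i))%:C%C)).
  by apply: ler_prod => i _; rewrite normr_ge0 cb.
rewrite -rmorph_prod lecR /b !big_split /= prodfV -expr_sum.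
rewrite sum_subn2// sk ler_pM2r ?invr_gt0 ?exprn_gt0//.
rewrite ler_wpM2r ?prodr_ge0// => [i _|]; first exact: C0.
rewrite powR_prodr// ge0_ler_powR ?nnegrE ?prodr_ge0//.
rewrite -natr_prod ler_nat -[in leqRHS]sk; exact: prod_fact_le.
Qed.

(** * Comparison with the Gaussian cumulants *)

Lemma cumulant_sum0 (F : numFieldType) (c : nat -> F) k :
  (0 < k)%N -> cumulant_sum c 0 k = 0.
Proof.
move=> k0; rewrite /cumulant_sum big1 ?mulr0// => s.
by rewrite big_ord0 eq_sym gtn_eqF ?andbF.
Qed.

(** For k < 2j there are no tuples at all, and for k = 2j only the constant tuple 2, to which both
    cumulant sequences give weight 1. *)
Lemma cumulant_sum_delta2 (F : numFieldType) (c : nat -> F) j k :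
  (k <= 2 * j)%N -> c 2 = 1 ->
  cumulant_sum c j k = cumulant_sum (fun i => (i == 2)%:R) j k.
Proof.
move=> kj c2; rewrite /cumulant_sum; congr (_ * _).
apply: eq_bigr => s /andP[/forallP s2 /eqP sk].
have s_2 i : s i = 2 :> nat.
  apply/eqP; rewrite eqn_leq s2 andbT leqNgt; apply/negP => si.
  have : (2 * j < \sum_(i < j) s i)%N; last by rewrite sk ltnNge kj.
  rewrite mulnC -[j in X in (X < _)%N]card_ord -sum_nat_const.
  rewrite (bigD1 i)//= [ltnRHS](bigD1 i)//= -addSn leq_add//.
  exact: leq_sum.
by congr (_ * _); apply: eq_bigr => i _; rewrite s_2 c2.
Qed.

(** A tuple of nonzero weight is constantly 2 and so has sum 2j, which differs from k. *)
Lemma cumulant_sum_delta2_eq0 (F : numFieldType) j k : (2 * j < k)%N ->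
  cumulant_sum (fun i => (i == 2)%:R : F) j k = 0.
Proof.
move=> jk; rewrite /cumulant_sum big1 ?mulr0// => s /andP[_ /eqP sk].
have [/forallP s2|] := boolP [forall i, s i == 2 :> nat].
  have : (\sum_(i < j) s i = j * 2)%N.
    by rewrite (eq_bigr (fun=> 2%N)) ?sum_nat_const ?card_ord// => i _; exact/eqP.
  by rewrite sk => kj; lia.
rewrite negb_forall => /existsP[i si].
by rewrite (bigD1 i)//= (negbTE si) mul0r mul0r.
Qed.

(** [k.-1./2] is the largest j with 2j < k, so the sum in the theorem stops just before the terms
    that agree for Z and N. *)
Lemma absz_ceil_half (R : realType) k : (3 <= k)%N ->
  `|Num.ceil (k%:R / 2 - 1 : R)|%N = k.-1./2.
Proof.
move=> k3; have -> : Num.ceil (k%:R / 2 - 1 : R) = k.-1./2%:Z; last by [].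
apply: ceil_def; rewrite intrB -pmulrn.
have /andP[] : (2 * k.-1./2 + 1 <= k <= 2 * k.-1./2 + 2)%N by lia.
rewrite -!(ler_nat R) !natrD -[1%:~R]/(1 : R); set m : R := (k.-1./2)%:R => h1 h2.
by apply/andP; split; lra.
Qed.

(** * Moments of the normal distribution *)

Section normal_moments.
Context {R : realType}.
Notation mu := (@lebesgue_measure R).
Notation phi := (@normal_pdf R 0 1).

Lemma normal_pdf01E x : phi x = normal_peak 1 * expR (- x ^+ 2 / 2).
Proof. by rewrite normal_pdfE ?oner_neq0// /normal_fun subr0 expr1n. Qed.

Lemma normal_pdf02E x :
  @normal_pdf R 0 2 x = normal_peak 2 * expR (- x ^+ 2 / 8).
Proof.
rewrite normal_pdfE ?pnatr_eq0// /normal_fun subr0.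
by congr (_ * expR (_ / _)); ring.
Qed.

(* The Gaussian of variance 4 absorbs every power of x. *)
Lemma exprn_normal_pdf_le k : exists2 M : R, 0 <= M &
  forall x, `|x ^+ k * phi x| <= M * normal_pdf 0 2 x.
Proof.
have p1 := @normal_peak_gt0 R 1 (oner_neq0 _).
have p2 : 0 < @normal_peak R 2 by rewrite normal_peak_gt0// pnatr_eq0.
(* Let y = |x|. As y^k <= exp(k y), it suffices that k y - y^2/2 <= k^2 - y^2/8, that is, (y/2 -
   k)^2 + y^2/8 >= 0. The quotient of the peaks adjusts the normalisations. *)
exists (normal_peak 1 * expR (k%:R ^+ 2) / normal_peak 2).
  by rewrite divr_ge0 ?mulr_ge0 ?expR_ge0// ltW.
move=> x; rewrite normal_pdf01E normal_pdf02E [leRHS]mulrA divfK ?gt_eqF//.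
rewrite mulrCA normrM (gtr0_norm p1) -mulrA ler_pM2l//.
rewrite normrM normrX (ger0_norm (expR_ge0 _)).
have xe : `|x| ^+ k <= expR (k%:R * `|x|).
  rewrite expRM_natl lerXn2r ?nnegrE ?expR_ge0//.
  by apply: le_trans (expR_ge1Dx _); lra.
apply: le_trans (ler_wpM2r (expR_ge0 _) xe) _.
rewrite -!expRD ler_expR.
rewrite -[x ^+ 2]real_normK ?num_real//.
have := sqr_ge0 (`|x| / 2 - k%:R); have := sqr_ge0 `|x|.
by move: `|x| (k%:R) => y z; nra.
Qed.

Lemma measurable_exprn_normal_pdf k :
  measurable_fun [set: R] (fun x => x ^+ k * phi x).
Proof. by apply: measurable_funM => //; exact: measurable_normal_pdf. Qed.

Lemma integrable_exprn_normal_pdf k :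
  mu.-integrable setT (EFin \o (fun x => x ^+ k * phi x)).
Proof.
have [M M0 Mle] := exprn_normal_pdf_le k.
have := integrableZl measurableT M (@integrable_normal_pdf R 0 2).
apply: le_integrable => //.
  by apply/measurable_EFinP; exact: measurable_exprn_normal_pdf.
move=> x _ /=; rewrite lee_fin (le_trans (Mle x))// ger0_norm//.
by rewrite mulr_ge0 ?normal_pdf_ge0.
Qed.

(** The density satisfies phi' = - x phi. For [k] = 0 the factor [k%:R] kills the term in which
    [k.-1] is meaningless. *)
Lemma is_derive_exprn_normal_pdf k (x : R) :
  is_derive x 1 (fun y => y ^+ k * phi y)
    (k%:R * (x ^+ k.-1 * phi x) - x ^+ k.+1 * phi x).
Proof.
rewrite (_ : (fun y => _) = (id ^+ k) *
    (normal_peak 1 *: (expR \o ((- 2^-1 : R) *: (id ^+ 2))))); last first.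
  apply/funext => y /=; rewrite normal_pdf01E !fctE /GRing.scale /=.
  by congr (_ * (_ * expR _)); lra.
rewrite !normal_pdf01E; apply: is_derive_eq.
rewrite /GRing.scale /= !fctE.
have -> : (- 2^-1 : R) *: x ^+ 2 = - x ^+ 2 / 2 by rewrite /GRing.scale /=; lra.
by rewrite [x ^+ k.+1]exprS /GRing.scale /=; field.
Qed.

Lemma continuous_exprn_normal_pdf k : continuous (fun x : R => x ^+ k * phi x).
Proof.
move=> x; apply: cvgM; first exact: exprn_continuous.
by apply: continuous_normal_pdf; exact: oner_neq0.
Qed.

(** One extra power of x is still bounded, which leaves a decay of order 1/(n+1). Prescribing only
    |u n| covers both endpoints of a symmetric interval. *)
Lemma exprn_normal_pdf_cvg0 k (u : R^nat) : (forall n, `|u n| = n.+1%:R) ->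
  u n ^+ k * phi (u n) @[n --> \oo] --> (0 : R).
Proof.
move=> un; have [M M0 Mle] := exprn_normal_pdf_le k.+1.
have p2 : 0 < @normal_peak R 2 by rewrite normal_peak_gt0// pnatr_eq0.
apply: norm_cvg0.
apply: (@squeeze_cvgr _ _ _ _ (cst 0) (fun n => (M * normal_peak 2) * n.+1%:R^-1)).
- apply/nearW => n /=; rewrite normr_ge0 /= ler_pdivlMr// -un -normrM mulrC.
  rewrite mulrA -exprS (le_trans (Mle _))// ler_wpM2l//.
  by rewrite normal_pdf_ub// pnatr_eq0.
- exact: cvg_cst.
- rewrite -(mulr0 (M * normal_peak 2)); apply: cvgM; first exact: cvg_cst.
  exact: cvg_harmonic.
Qed.

(** By the fundamental theorem of calculus the integral over [-(n+1), n+1] is a difference of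
    boundary values tending to 0; by dominated convergence, with |f| as majorant, it also tends to
    the full integral. *)
Lemma Rintegral_derive_exprn_normal_pdf k :
  \int[mu]_x (k%:R * (x ^+ k.-1 * phi x) - x ^+ k.+1 * phi x) = 0.
Proof.
pose F (x : R) := x ^+ k * phi x.
pose f (x : R) := k%:R * (x ^+ k.-1 * phi x) - x ^+ k.+1 * phi x.
have cf : continuous f.
  move=> x; apply: cvgB; last exact: continuous_exprn_normal_pdf.
  by apply: cvgM; [exact: cvg_cst|exact: continuous_exprn_normal_pdf].
have intf : mu.-integrable setT (EFin \o f).
  have := integrableB measurableT
    (integrableZl measurableT k%:R (integrable_exprn_normal_pdf k.-1))
    (integrable_exprn_normal_pdf k.+1).
  by apply: eq_integrable.
have FTC n : \int[mu]_(x in `[- n.+1%:R, n.+1%:R]) f x =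
    F n.+1%:R - F (- n.+1%:R).
  rewrite /Rintegral (@continuous_FTC2 _ f F)//.
  - have : (0 : R) < n.+1%:R by []. 
    lra.
  - by apply: continuous_subspaceT => x; exact: cf.
  - split.
    + by move=> x _; have [] := is_derive_exprn_normal_pdf k x.
    + by apply: cvg_at_right_filter; exact: continuous_exprn_normal_pdf.
    + by apply: cvg_at_left_filter; exact: continuous_exprn_normal_pdf.
  - move=> x _; rewrite derive1E.
    by have [_ ->] := is_derive_exprn_normal_pdf k x.
have lim0 : \int[mu]_(x in `[- n.+1%:R, n.+1%:R]) f x @[n --> \oo] --> (0 : R).
  under eq_fun do rewrite FTC.
  have := @cvgB _ _ _ _ _ _ _ _ _
    (@exprn_normal_pdf_cvg0 k (fun n => n.+1%:R) (fun n => ger0_norm (ler0n _ _)))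
    (@exprn_normal_pdf_cvg0 k (fun n => - n.+1%:R)
      (fun n => etrans (normrN _) (ger0_norm (ler0n _ _)))).
  by rewrite subrr => h; exact: h.
apply/esym/(cvg_unique _ lim0) => //.
apply: fine_cvg; rewrite fineK; last exact: integrable_fin_num.
under eq_fun do rewrite integral_mkcond.
apply: (@dominated_cvg _ _ _ mu setT measurableT
  (fun n => (fun x => (f x)%:E) \_ `[- n.+1%:R, n.+1%:R]%classic)
  (EFin \o f) (fun x => `|(f x)%:E|)%E) => //.
- move=> n; apply/(measurable_restrictT _ _).1 => //.
  by apply: measurable_funTS; exact: (measurable_int mu intf).
- move=> x _; apply: cvg_near_cst.
  near=> n; rewrite patchE mem_set//= in_itv/= -ler_norml.
  rewrite (@le_trans _ _ n%:R) ?ler_nat//; near: n; exact: nbhs_infty_ger.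
- exact: integrable_abse.
- by move=> n x _; rewrite patchE; case: ifP => //; rewrite abse0 abse_ge0.
Unshelve. all: end_near. 
Qed.

(* Stein's identity: the derivative of x^k phi(x) integrates to 0. *)
Lemma Rintegral_exprnS_normal_pdf k :
  \int[mu]_x (x ^+ k.+1 * phi x) = k%:R * \int[mu]_x (x ^+ k.-1 * phi x).
Proof.
have := Rintegral_derive_exprn_normal_pdf k.
rewrite RintegralB//; last 2 first.
- have := integrableZl measurableT k%:R (integrable_exprn_normal_pdf k.-1).
  by apply: eq_integrable.
- exact: integrable_exprn_normal_pdf.
rewrite RintegralZl//; last exact: integrable_exprn_normal_pdf.
by move/eqP; rewrite subr_eq0 => /eqP.
Qed.

End normal_moments.

(** * Integration against the normal law through its density *)

Section normal_density_integral.
Context {R : realType} (m s : R).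
Notation mu := (@lebesgue_measure R).

(** Both functions have the same integral over every measurable set. *)
Lemma ae_eq_Radon_Nikodym_normal_prob :
  ae_eq mu setT (Radon_Nikodym_SigmaFinite.f (normal_prob m s) mu)
    (EFin \o normal_pdf m s).
Proof.
have dom := normal_prob_dominates m s.
apply: integral_ae_eq => //.
- exact: Radon_Nikodym_SigmaFinite.f_integrable.
- by apply/measurable_EFinP; exact: measurable_normal_pdf.
- by move=> A _ mA; rewrite -Radon_Nikodym_SigmaFinite.f_integral.
Qed.

(** The nonnegative case comes first: applied to |f|, it supplies the integrability on which the
    signed case rests. *)
Lemma ge0_integral_normal_prob (f : R -> \bar R) :
  measurable_fun setT f -> (forall x, 0 <= f x)%E ->
  (\int[normal_prob m s]_x f x = \int[mu]_x (f x * (normal_pdf m s x)%:E))%E.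
Proof.
move=> mf f0; have dom := normal_prob_dominates m s.
rewrite -(Radon_Nikodym_SigmaFinite.change_of_variables dom)//.
apply: ae_eq_integral => //.
- apply: emeasurable_funM => //; apply: (measurable_int mu).
  exact: Radon_Nikodym_SigmaFinite.f_integrable.
- apply: emeasurable_funM => //.
  by apply/measurable_EFinP; exact: measurable_normal_pdf.
- exact: ae_eqe_mul2l ae_eq_Radon_Nikodym_normal_prob.
Qed.

Lemma integrable_normal_prob (f : R -> R) : measurable_fun setT f ->
  mu.-integrable setT (EFin \o (fun x => f x * normal_pdf m s x)) ->
  (normal_prob m s).-integrable setT (EFin \o f).
Proof.
move=> mf /integrableP[_ foo]; apply/integrableP; split; first exact/measurable_EFinP.
rewrite ge0_integral_normal_prob//; last first.
  by do 2 apply: measurableT_comp => //.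
move: foo; congr (_ < _)%E; apply: eq_integral => x _ /=.
by rewrite normrM EFinM (ger0_norm (normal_pdf_ge0 m s x)).
Qed.

Lemma integral_normal_prob (f : R -> R) : measurable_fun setT f ->
  mu.-integrable setT (EFin \o (fun x => f x * normal_pdf m s x)) ->
  (\int[normal_prob m s]_x (f x)%:E = \int[mu]_x (f x * normal_pdf m s x)%:E)%E.
Proof.
move=> mf intf; have intfn := integrable_normal_prob mf intf.
have dom := normal_prob_dominates m s.
rewrite -(Radon_Nikodym_change_of_variables dom)//.
apply: ae_eq_integral => //.
- by apply: emeasurable_funM => //; exact/measurable_EFinP.
- exact: (measurable_int mu intf).
(* The derivative in this change of variables is the one for charges; it agrees almost everywhere
   with the sigma-finite one, hence with the density. *)
- apply: (@ae_eqe_mul2l _ _ _ mu setT _ (EFin \o normal_pdf m s) (EFin \o f)).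
  apply: ae_eq_trans ae_eq_Radon_Nikodym_normal_prob.
  by apply: ae_eq_sym; exact: ae_eq_Radon_Nikodym_SigmaFinite.
Qed.

End normal_density_integral.

(** * Moments of a normally distributed random variable *)

Section normal_moments.
Context {R : realType} d (T : measurableType d) (P : probability T R).
Variable N : {RV P >-> R}.
Hypothesis N_normal : forall A : set (measurableTypeR R), measurable A ->
     distribution P N A = normal_prob 0 1 A.

(* The sigma-algebra carried by R itself and the one of measurableTypeR R have
   the same measurable sets, but different displays. *)
Let mN : measurable_fun setT (N : T -> measurableTypeR R).
Proof. exact: (@measurable_funPT _ _ _ _ N). Qed.

Let N_mfun := isMeasurableFun.Build _ _ _ _ (N : T -> measurableTypeR R) mN.

Let N' : {RV P >-> measurableTypeR R} := HB.pack (N : T -> measurableTypeR R) N_mfun.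

Lemma expectation_exprn_normal k :
  ('E_P[fun w => (N w ^+ k)%R] =
   (\int[lebesgue_measure]_x (x ^+ k * normal_pdf 0 1 x))%:E)%E.
Proof.
have mX : measurable_fun [set: R] (fun x : R => x ^+ k) by exact: exprn_measurable.
have intX := integrable_exprn_normal_pdf (R := R) k.
have dE (f : measurableTypeR R -> \bar R) :
    (\int[distribution P N']_x f x = \int[normal_prob 0 1]_x f x)%E.
  by apply: eq_measure_integral => A mA _; exact: N_normal.
rewrite unlock /Rintegral fineK; last exact: integrable_fin_num.
rewrite -integral_normal_prob// -dE integral_distribution//.
  exact/measurable_EFinP.
have /integrableP[mi ioo] := integrable_normal_prob mX intX.
apply/integrableP; split.
  by apply/measurable_EFinP; exact: (measurableT_comp mX (measurable_funPT N)).
move: ioo; rewrite -dE ge0_integral_distribution//.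
by do 2 apply: measurableT_comp => //.
Qed.

Lemma normal_momentS k :
  fine 'E_P[fun w => (N w ^+ k.+1)%R] = k%:R * fine 'E_P[fun w => (N w ^+ k.-1)%R].
Proof. by rewrite !expectation_exprn_normal /= Rintegral_exprnS_normal_pdf. Qed.

End normal_moments.

(** * Derivatives of the characteristic function *)

Section trigonometric_moments.
Context {R : realType} d (T : measurableType d) (P : probability T R).
Variable X : {RV P >-> R}.
Hypothesis X_moments : forall j : nat, ('E_P[fun w => (`|X w| ^+ j)%R] < +oo)%E.

Let mX : measurable_fun setT X. Proof. exact: measurable_funPT. Qed.

Lemma integrable_normrX j : P.-integrable setT (EFin \o (fun w => `|X w| ^+ j)).
Proof.
apply/integrableP; split.
  by apply/measurable_EFinP; apply: measurable_funX; exact: measurableT_comp.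
have := X_moments j; rewrite unlock; congr (_ < _)%E.
by apply: eq_integral => w _ /=; rewrite normrX normr_id.
Qed.

Lemma integrable_exprn_bounded k (g : R -> R) t :
  measurable_fun setT g -> (forall x, `|g x| <= 1) ->
  P.-integrable setT (EFin \o (fun w => X w ^+ k * g (t * X w))).
Proof.
move=> mg g1; apply: le_integrable (integrable_normrX k) => //.
  apply/measurable_EFinP; apply: measurable_funM; first exact: measurable_funX.
  by apply: measurableT_comp => //; apply: measurable_funM.
move=> w _ /=; rewrite lee_fin normrM normrX [leRHS]ger0_norm ?exprn_ge0//.
by rewrite ler_piMr ?exprn_ge0.
Qed.

Lemma integrable_exprn k : P.-integrable setT (EFin \o (fun w => X w ^+ k)).
Proof.
have g1 (x : R) : `|cst 1 x| <= 1 :> R by rewrite /= normr1.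
have := integrable_exprn_bounded k 0 (measurable_cst _) g1.
by apply: eq_integrable => // w _ /=; rewrite mulr1.
Qed.

(** Differentiation under the integral sign: the derivative in s is dominated by |X|^(k+1),
    uniformly in s, and this is integrable by the moment hypothesis. *)
Lemma is_derive_Rintegral_exprn k (g dg : R -> R) (t : R) :
  measurable_fun setT g -> (forall x, `|g x| <= 1) ->
  (forall x : R, is_derive x 1 g (dg x)) -> (forall x, `|dg x| <= 1) ->
  is_derive t 1 (fun s => \int[P]_w (X w ^+ k * g (s * X w)))
    (\int[P]_w (X w ^+ k.+1 * dg (t * X w))).
Proof.
move=> mg g1 g'E dg1.
pose f (s : R) w := X w ^+ k * g (s * X w).
have fE (s : R) w : is_derive s 1 (f ^~ w) (X w ^+ k.+1 * dg (s * X w)).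
  rewrite (_ : (fun x => f x w) = (X w ^+ k) *: (g \o (X w *: id))); last first.
    by apply/funext => y; rewrite /f !fctE /GRing.scale /= mulrC [y * _]mulrC mulrC.
  have := g'E (X w * s) => g'Es.
  apply: is_derive_eq.
  by rewrite /GRing.scale /= mulr1 [s * _]mulrC exprS; ring.
have tI : `]t - 1, t + 1[%classic t by rewrite /= in_itv /=; lra.
have intf s : `]t - 1, t + 1[%classic s -> P.-integrable setT (EFin \o f s).
  by move=> _; exact: integrable_exprn_bounded.
have derf s w : `]t - 1, t + 1[%classic s -> [set: T] w -> derivable (f ^~ w) s 1.
  by move=> _ _; have [] := fE s w.
have G_ub s w : `]t - 1, t + 1[%classic s -> [set: T] w ->
    `|partial1of2 f s w| <= `|X w| ^+ k.+1.
  move=> _ _; rewrite partial1of2E; have [_ ->] := fE s w.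
  by rewrite normrM normrX ler_piMr ?exprn_ge0.
have G_ge0 w : 0 <= `|X w| ^+ k.+1 by rewrite exprn_ge0.
split.
  exact: (derivable_under_integral measurableT tI intf derf G_ge0
            (integrable_normrX k.+1) G_ub).
rewrite -derive1E (differentiation_under_integral measurableT tI intf derf G_ge0
            (integrable_normrX k.+1) G_ub).
apply: eq_Rintegral => w _.
by rewrite partial1of2E; have [_ ->] := fE t w.
Qed.

Let measurable_cos : measurable_fun setT (@cos R).
Proof. apply: continuous_measurable_fun; exact: continuous_cos. Qed.

Let measurable_sin : measurable_fun setT (@sin R).
Proof. apply: continuous_measurable_fun; exact: continuous_sin. Qed.

(** These are the real and imaginary parts of E[X^k exp(itX)]. *)
Definition cos_moment k (t : R) := \int[P]_w (X w ^+ k * cos (t * X w)).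
Definition sin_moment k (t : R) := \int[P]_w (X w ^+ k * sin (t * X w)).

Lemma is_derive_cos_moment k (t : R) :
  is_derive t 1 (cos_moment k) (- sin_moment k.+1 t).
Proof.
have -> : - sin_moment k.+1 t = \int[P]_w (X w ^+ k.+1 * (- sin (t * X w))).
  rewrite /sin_moment -mulN1r -RintegralZl//.
    by apply: eq_Rintegral => w _; ring.
  by apply: integrable_exprn_bounded => // x; rewrite sin_max.
apply: (@is_derive_Rintegral_exprn _ _ (fun x => - sin x)) => //.
- by move=> x; rewrite cos_max.
- by move=> x; rewrite normrN sin_max.
Qed.

Lemma is_derive_sin_moment k (t : R) : is_derive t 1 (sin_moment k) (cos_moment k.+1 t).
Proof.
apply: is_derive_Rintegral_exprn => //.
- by move=> x; rewrite sin_max.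
- by move=> x; rewrite cos_max.
Qed.

Lemma cos_moment_at0 k : cos_moment k 0 = fine 'E_P[fun w => (X w ^+ k)%R].
Proof.
rewrite unlock; apply: eq_Rintegral => w _.
by rewrite mul0r cos0 mulr1.
Qed.

Lemma sin_moment_at0 k : sin_moment k 0 = 0.
Proof.
rewrite /sin_moment; under eq_Rintegral do rewrite mul0r sin0 mulr0.
by rewrite Rintegral_cst ?mul0r.
Qed.

Lemma charfunE t : charfun P X t = (cos_moment 0 t +i* sin_moment 0 t)%C.
Proof.
rewrite /charfun /cexpectation unlock; congr (_ +i* _)%C; apply: eq_Rintegral => w _ /=.
  by rewrite mul1r.
by rewrite mul1r.
Qed.

Lemma is_derive_Re_Im_mul (z : R[i]) (p q : R -> R) (t dp dq : R) :
  is_derive t 1 p dp -> is_derive t 1 q dq ->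
  is_derive t 1 (fun s => complex.Re (z * (p s +i* q s))%C)
    (complex.Re (z * (dp +i* dq))%C) /\
  is_derive t 1 (fun s => complex.Im (z * (p s +i* q s))%C)
    (complex.Im (z * (dp +i* dq))%C).
Proof.
case: z => a b Dp Dq /=; split.
  exact: (is_deriveB (is_deriveZ a Dp) (is_deriveZ b Dq)).
exact: (is_deriveD (is_deriveZ a Dq) (is_deriveZ b Dp)).
Qed.

Let i_cos_sin_moment n t : R[i] := ('i%C ^+ n * (cos_moment n t +i* sin_moment n t))%C.

(** Since i (c + i s) = - s + i c, one further factor i accounts for the sign and the swap of cosine
    and sine under differentiation. *)
Let is_derive_i_moment n (t : R) :
  is_derive t 1 (fun s => complex.Re (i_cos_sin_moment n s))
    (complex.Re (i_cos_sin_moment n.+1 t)) /\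
  is_derive t 1 (fun s => complex.Im (i_cos_sin_moment n s))
    (complex.Im (i_cos_sin_moment n.+1 t)).
Proof.
have -> : i_cos_sin_moment n.+1 t =
    ('i%C ^+ n * (- sin_moment n.+1 t +i* cos_moment n.+1 t))%C.
  rewrite /i_cos_sin_moment exprSr -mulrA; congr (_ * _).
  by apply/eqP; rewrite eq_complex /=; apply/andP; split; apply/eqP; ring.
by apply: is_derive_Re_Im_mul;
  [exact: is_derive_cos_moment|exact: is_derive_sin_moment].
Qed.

Let derive1n_charfun n :
  derive1n n (fun s => complex.Re (charfun P X s)) =
    (fun s => complex.Re (i_cos_sin_moment n s)) /\
  derive1n n (fun s => complex.Im (charfun P X s)) =
    (fun s => complex.Im (i_cos_sin_moment n s)).
Proof.
elim: n => [|n [IHRe IHIm]].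
  by split; apply/funext => s; rewrite derive1n0 /i_cos_sin_moment expr0 mul1r charfunE.
rewrite !derive1nS IHRe IHIm; split; apply/funext => s; rewrite derive1E.
  by have [[_ ->]] := is_derive_i_moment n s.
by have [_ [_ ->]] := is_derive_i_moment n s.
Qed.

Lemma derivable_charfun n (t : R) :
  derivable (derive1n n (fun s => complex.Re (charfun P X s))) t 1 /\
  derivable (derive1n n (fun s => complex.Im (charfun P X s))) t 1.
Proof.
have [-> ->] := derive1n_charfun n.
by have [[dRe _] [dIm _]] := is_derive_i_moment n t.
Qed.

Lemma cderive1n_charfun n t :
  cderive1n n (charfun P X) t = ('i%C ^+ n * (cos_moment n t +i* sin_moment n t))%C.
Proof.
rewrite /cderive1n; have [-> ->] := derive1n_charfun n.
by rewrite -/(i_cos_sin_moment n t); case: (i_cos_sin_moment n t).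
Qed.

End trigonometric_moments.

(** * Iterated derivatives and Leibniz' rule *)

(** Pascal's rule, after padding the second sum with the vanishing coefficient 'C(n, n.+1); this is
    the induction step of Leibniz' rule. *)
Lemma pascal_sum (F : pzSemiRingType) (a b : nat -> F) n :
  \sum_(i < n.+1) 'C(n, i)%:R * (a i.+1 * b (n - i)%N) +
  \sum_(i < n.+1) 'C(n, i)%:R * (a i * b (n.+1 - i)%N) =
  \sum_(i < n.+2) 'C(n.+1, i)%:R * (a i * b (n.+1 - i)%N).
Proof.
have -> : \sum_(i < n.+1) 'C(n, i)%:R * (a i * b (n.+1 - i)%N) =
    \sum_(i < n.+2) 'C(n, i)%:R * (a i * b (n.+1 - i)%N).
  by rewrite [RHS]big_ord_recr /= bin_small// mul0r addr0.
rewrite [X in _ + X = _]big_ord_recl [RHS]big_ord_recl addrCA !bin0; congr (_ + _).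
rewrite -big_split; apply: eq_bigr => i _ /=.
by rewrite /bump !add1n subSS binS natrD mulrDl addrC.
Qed.

Section iterated_derivatives.
Context {R : realType}.
Variable U : set R.
Hypothesis openU : open U.
Implicit Types f g : R -> R.

Let nearU (f g : R -> R) x : U x -> (forall y, U y -> f y = g y) ->
  \forall y \near x, f y = g y.
Proof.
move=> Ux fg; near=> y; apply: fg; near: y.
by apply: open_nbhs_nbhs.
Unshelve. all: end_near. Qed.

Lemma derive1_eq_on f g : (forall y, U y -> f y = g y) ->
  forall y, U y -> derive1 f y = derive1 g y.
Proof.
by move=> fg y Uy; rewrite !derive1E; apply: near_eq_derive; exact: nearU.
Qed.

Lemma derive1n_eq_on n f g : (forall y, U y -> f y = g y) ->
  forall y, U y -> derive1n n f y = derive1n n g y.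
Proof. by move=> fg; elim: n => // n IH; exact: derive1_eq_on. Qed.

(** The recursion passes to [derive1 f], so that inductions on the order can generalise over the
    function. *)
Fixpoint derivable_on n f : Prop :=
  if n is n'.+1 then (forall x, U x -> derivable f x 1) /\ derivable_on n' (derive1 f)
  else True.

Lemma derivable_on_eq n f g : (forall y, U y -> f y = g y) ->
  derivable_on n f -> derivable_on n g.
Proof.
elim: n f g => //= n IH f g fg [df Df]; split; last first.
  by apply: IH Df; exact: derive1_eq_on.
by move=> x Ux; apply: near_eq_derivable (df _ Ux); exact: nearU.
Qed.

Lemma derivable_onW n f : derivable_on n.+1 f -> derivable_on n f.
Proof. by elim: n f => //= n IH f [df /IH Df]. Qed.

Lemma derivable_onD n f g :
  derivable_on n f -> derivable_on n g -> derivable_on n (f + g).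
Proof.
elim: n f g => //= n IH f g [df Df] [dg Dg]; split.
  by move=> x Ux; apply: derivableD; [exact: df|exact: dg].
apply: derivable_on_eq (IH _ _ Df Dg) => x Ux.
by rewrite [RHS]derive1E deriveD -?derive1E//; [exact: df|exact: dg].
Qed.

Lemma derivable_onN n f : derivable_on n f -> derivable_on n (- f).
Proof.
elim: n f => //= n IH f [df Df]; split.
  by move=> x Ux; apply: derivableN; exact: df.
apply: derivable_on_eq (IH _ Df) => x Ux.
by rewrite [RHS]derive1E deriveN -?derive1E//; exact: df.
Qed.

Lemma derive1M_on f g x : derivable f x 1 -> derivable g x 1 ->
  derive1 (f * g) x = (derive1 f * g + f * derive1 g) x.
Proof.
move=> df dg; rewrite derive1E deriveM// /GRing.scale /= -!derive1E !fctE.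
by rewrite addrC; congr (_ + _); exact: mulrC.
Qed.

Lemma derivable_onM n f g :
  derivable_on n f -> derivable_on n g -> derivable_on n (f * g).
Proof.
elim: n f g => //= n IH f g Df Dg.
have [df Df'] := Df; have [dg Dg'] := Dg; split.
  by move=> x Ux; apply: derivableM; [exact: df|exact: dg].
apply: (@derivable_on_eq _ (derive1 f * g + f * derive1 g)).
  by move=> x Ux; rewrite derive1M_on//; [exact: df|exact: dg].
by apply: derivable_onD; apply: IH => //; exact: derivable_onW.
Qed.

(** The derivative - f' (1/f)^2 contains 1/f only to the order granted by the induction
    hypothesis. *)
Lemma derivable_onV n f : (forall x, U x -> f x != 0) ->
  derivable_on n f -> derivable_on n (fun x => (f x)^-1).
Proof.
move=> f0; elim: n => //= n IH Df; have [df Df'] := Df; split.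
  by move=> x Ux; apply: derivableV; [exact: f0|exact: df].
have DV := IH (derivable_onW Df).
apply: (@derivable_on_eq _ (- (derive1 f * ((fun x => (f x)^-1) * (fun x => (f x)^-1))))).
  move=> x Ux; rewrite [RHS]derive1E deriveV; [|exact: f0|exact: df].
  rewrite !fctE /GRing.scale /=.
  by rewrite derive1E expr2 invfM; ring.
by apply: derivable_onN; apply: derivable_onM => //; exact: derivable_onM.
Qed.

Lemma derive1nD_on n f g : derivable_on n f -> derivable_on n g ->
  forall x, U x -> derive1n n (f + g) x = derive1n n f x + derive1n n g x.
Proof.
elim: n f g => // n IH f g [df Df] [dg Dg] x Ux.
rewrite !derive1Sn -IH//; apply: derive1n_eq_on => // y Uy.
by rewrite derive1E deriveD -?derive1E//; [exact: df|exact: dg].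
Qed.

Lemma derive1nB_on n f g : derivable_on n f -> derivable_on n g ->
  forall x, U x -> derive1n n (f - g) x = derive1n n f x - derive1n n g x.
Proof.
elim: n f g => // n IH f g [df Df] [dg Dg] x Ux.
rewrite !derive1Sn -IH//; apply: derive1n_eq_on => // y Uy.
by rewrite derive1E deriveB -?derive1E//; [exact: df|exact: dg].
Qed.

Lemma leibniz_derive1n n f g : derivable_on n f -> derivable_on n g ->
  forall x, U x -> derive1n n (f * g) x =
    \sum_(i < n.+1) 'C(n, i)%:R * (derive1n i f x * derive1n (n - i) g x).
Proof.
elim: n f g => [|n IH] f g Df Dg x Ux.
  by rewrite big_ord1 mul1r.
have [df Df'] := Df; have [dg Dg'] := Dg.
have Dfn := derivable_onW Df; have Dgn := derivable_onW Dg.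
transitivity (derive1n n (derive1 f * g) x + derive1n n (f * derive1 g) x).
  rewrite derive1Sn -derive1nD_on//; last 2 first.
  - exact: derivable_onM.
  - exact: derivable_onM.
  by apply: derive1n_eq_on => // y Uy; rewrite derive1M_on//; [exact: df|exact: dg].
have f'n i : derive1n i (derive1 f) x = derive1n i.+1 f x by rewrite derive1Sn.
have g'n (i : 'I_n.+1) : derive1n (n - i) (derive1 g) x = derive1n (n.+1 - i) g x.
  by rewrite -derive1Sn subSn// -ltnS.
rewrite !IH//; under eq_bigr do rewrite f'n.
under [X in _ + X = _]eq_bigr do rewrite g'n.
exact: (pascal_sum (fun i => derive1n i f x) (fun i => derive1n i g x) n).
Qed.

End iterated_derivatives.

Lemma derivable_onS (R : realType) (U V : set R) n f :
  U `<=` V -> derivable_on V n f -> derivable_on U n f.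
Proof.
move=> UV; elim: n f => //= n IH f [df Df]; split; last exact: IH.
by move=> x Ux; apply: df; exact: UV.
Qed.

(** * The principal logarithm of a smooth curve *)

Section principal_logarithm.
Context {R : realType}.
Implicit Types x y : R.

(** In the right half-plane the argument has positive cosine, so it lies in ]-pi/2, pi/2[, where
    [atan] inverts [tan]. *)
Lemma carg_atan x y : 0 < x -> carg (x +i* y)%C = atan (y / x).
Proof.
move=> x0; set z := (x +i* y)%C.
have z0 : z != 0 by rewrite eq_complex /= negb_and gt_eqF.
have [/andP[_ lepi] zE] := cargP z0; have [/andP[gtNpi _] _] := cargP z0.
set a := carg z in lepi gtNpi zE *.
have m0 : 0 < cmod z.
  rewrite /cmod normc_def /= sqrtr_gt0 (@lt_le_trans _ _ (x ^+ 2))//.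
    by rewrite exprn_gt0.
  by rewrite lerDl sqr_ge0.
have [xE yE] : x = cmod z * cos a /\ y = cmod z * sin a.
  move: zE; rewrite /expi; set m := cmod z; rewrite {1}/z => /eqP.
  by rewrite eq_complex /= !mul0r subr0 addr0 => /andP[/eqP-> /eqP->].
have cosa : 0 < cos a by move: x0; rewrite xE pmulr_rgt0.
have -> : y / x = tan a by rewrite xE yE /tan -mulf_div divff ?mul1r// gt_eqF.
have pi0 := pi_gt0 R.
rewrite tanK// in_itv /= -ltr_norml.
(* Cosine decreases on [0, pi], so cos |a| > 0 = cos (pi/2) means |a| < pi/2. *)
rewrite -ltr_cos ?cos_norm ?cos_pihalf//.
  by rewrite in_itv /= normr_ge0 ler_norml lepi andbT ltW.
by rewrite in_itv /=; apply/andP; split; lra.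
Qed.

(** This form is free of the square root and of the case distinction in [carg], leaving components
    to which the chain rule applies. *)
Lemma clogE x y : 0 < x ->
  clog (x +i* y)%C = (2^-1 * ln (x ^+ 2 + y ^+ 2) +i* atan (y / x))%C.
Proof.
move=> x0; rewrite /clog carg_atan// /cmod normc_def /=; congr (_ +i* _)%C.
have s0 : 0 < x ^+ 2 + y ^+ 2 by rewrite ltr_wpDr ?sqr_ge0 ?exprn_gt0.
rewrite -[in RHS](sqr_sqrtr (ltW s0)) lnXn ?sqrtr_gt0//.
by rewrite -[X in 2^-1 * X]mulr_natl mulKf.
Qed.

(** For f = u + i v this is the real part of f'/f = f' conj(f) / |f|^2; the next lemma treats the
    imaginary part. *)
Lemma is_derive_Re_clog (u v : R -> R) (t du dv : R) :
  is_derive t 1 u du -> is_derive t 1 v dv -> 0 < u t ->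
  is_derive t 1 (fun s => 2^-1 * ln (u s ^+ 2 + v s ^+ 2))
    ((u t * du + v t * dv) / (u t ^+ 2 + v t ^+ 2)).
Proof.
move=> Du Dv u0.
have s0 : 0 < u t ^+ 2 + v t ^+ 2 by rewrite ltr_wpDr ?sqr_ge0 ?exprn_gt0.
rewrite (_ : (fun s => _) = 2^-1 *: (@ln R \o (u ^+ 2 + v ^+ 2))); last by [].
have Dln : is_derive ((u ^+ 2 + v ^+ 2) t) 1 (@ln R) (u t ^+ 2 + v t ^+ 2)^-1.
  exact: is_derive1_ln.
apply: is_derive_eq.
by rewrite /GRing.scale /=; field; rewrite gt_eqF.
Qed.

Lemma is_derive_Im_clog (u v : R -> R) (t du dv : R) :
  is_derive t 1 u du -> is_derive t 1 v dv -> 0 < u t ->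
  is_derive t 1 (fun s => atan (v s / u s))
    ((u t * dv - v t * du) / (u t ^+ 2 + v t ^+ 2)).
Proof.
move=> Du Dv u0.
have s0 : 0 < u t ^+ 2 + v t ^+ 2 by rewrite ltr_wpDr ?sqr_ge0 ?exprn_gt0.
have ut0 : u t != 0 by rewrite gt_eqF.
rewrite (_ : (fun s => _) = @atan R \o (v * (fun s => (u s)^-1))); last by [].
have DV := is_deriveV ut0 Du.
apply: is_derive_eq.
by rewrite /GRing.scale /= !fctE; field; rewrite ut0 gt_eqF.
Qed.

Variable U : set R.
Hypothesis openU : open U.
Variable f : R -> R[i].
Hypothesis f_smooth : forall n,
  derivable_on U n (fun t => complex.Re (f t)) /\
  derivable_on U n (fun t => complex.Im (f t)).
Hypothesis Ref_gt0 : forall t, U t -> 0 < complex.Re (f t).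

Let u t := complex.Re (f t).
Let v t := complex.Im (f t).
Let q t := (u t ^+ 2 + v t ^+ 2)^-1.
(** [a] and [b] are the real and imaginary parts of f'/f. *)
Let a := (u * derive1 u + v * derive1 v) * q.
Let b := (u * derive1 v - v * derive1 u) * q.

Let sn t : U t -> u t ^+ 2 + v t ^+ 2 != 0.
Proof. by move=> Ut; rewrite gt_eqF// ltr_wpDr ?sqr_ge0 ?exprn_gt0 ?Ref_gt0. Qed.

Let Du n : derivable_on U n u. Proof. by have [] := f_smooth n. Qed.
Let Dv n : derivable_on U n v. Proof. by have [] := f_smooth n. Qed.
Let Du' n : derivable_on U n (derive1 u). Proof. by have [] := Du n.+1. Qed.
Let Dv' n : derivable_on U n (derive1 v). Proof. by have [] := Dv n.+1. Qed.

Let Dq n : derivable_on U n q.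
Proof.
apply: derivable_onV => //.
by apply: (derivable_onD openU (derivable_onM openU _ _) (derivable_onM openU _ _)).
Qed.

Let Da n : derivable_on U n a.
Proof.
by apply: derivable_onM => //; apply: derivable_onD => //; exact: derivable_onM.
Qed.

Let Db n : derivable_on U n b.
Proof.
apply: derivable_onM => //; apply: derivable_onD => //; first exact: derivable_onM.
by apply: derivable_onN => //; exact: derivable_onM.
Qed.

Let is_derive1_on (g : R -> R) t : derivable_on U 1 g -> U t ->
  is_derive t 1 g (derive1 g t).
Proof. by move=> [dg _] Ut; rewrite derive1E; exact/derivableP/dg. Qed.

(** The first derivative turns the logarithm into f'/f throughout the open set [U]; the remaining
    [n] act on [a] and [b]. *)
Lemma cderive1n_clogS n t : U t ->
  cderive1n n.+1 (clog \o f) t = (derive1n n a t +i* derive1n n b t)%C.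
Proof.
move=> Ut.
have clogfE s : U s -> clog (f s) =
    (2^-1 * ln (u s ^+ 2 + v s ^+ 2) +i* atan (v s / u s))%C.
  by move=> Us; rewrite -clogE ?Ref_gt0// /u /v; case: (f s).
have Ds s : U s -> is_derive s 1 u (derive1 u s) /\ is_derive s 1 v (derive1 v s).
  by move=> Us; split; exact: is_derive1_on.
rewrite /cderive1n !derive1Sn; congr (_ +i* _)%C;
  apply: (derive1n_eq_on openU) => // s Us.
- rewrite (derive1_eq_on openU
    (g := fun s => 2^-1 * ln (u s ^+ 2 + v s ^+ 2)))//; last first.
    by move=> y Uy; rewrite [(_ \o _) y]clogfE.
  have [Dus Dvs] := Ds s Us.
  by rewrite derive1E; have [_ ->] := is_derive_Re_clog Dus Dvs (Ref_gt0 Us).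
- rewrite (derive1_eq_on openU (g := fun s => atan (v s / u s)))//; last first.
    by move=> y Uy; rewrite [(_ \o _) y]clogfE.
  have [Dus Dvs] := Ds s Us.
  by rewrite derive1E; have [_ ->] := is_derive_Im_clog Dus Dvs (Ref_gt0 Us).
Qed.

(* Leibniz' rule applied to f' = f (log f)'. *)
Lemma cderive1nS_clog n t : U t ->
  cderive1n n.+1 f t =
  \sum_(i < n.+1) 'C(n, i)%:R * cderive1n i f t *
    cderive1n (n.+1 - i) (clog \o f) t.
Proof.
move=> Ut.
(* The identity f' = f (a + i b), split into components. *)
have u'E s : U s -> derive1 u s = (u * a - v * b) s.
  by move=> Us; rewrite /a /b !fctE /q; field; exact: sn.
have v'E s : U s -> derive1 v s = (u * b + v * a) s.
  by move=> Us; rewrite /a /b !fctE /q; field; exact: sn.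
have -> : cderive1n n.+1 f t =
    (derive1n n (u * a - v * b) t +i* derive1n n (u * b + v * a) t)%C.
  by rewrite /cderive1n !derive1Sn; congr (_ +i* _)%C; apply: (derive1n_eq_on openU).
rewrite (derive1nB_on openU)//; [|exact: derivable_onM|exact: derivable_onM].
rewrite (derive1nD_on openU)//; [|exact: derivable_onM|exact: derivable_onM].
rewrite !(leibniz_derive1n openU)//.
rewrite -sumrB -big_split /=.
have csum (F G : 'I_n.+1 -> R) :
    ((\sum_i F i) +i* (\sum_i G i))%C = \sum_i (F i +i* G i)%C.
  apply/eqP; rewrite eq_complex; apply/andP; split; apply/eqP => /=.
    by rewrite (raddf_sum (@complex.Re R)).
  by rewrite (raddf_sum (@complex.Im R)).
rewrite csum; apply: eq_bigr => i _.
(* As i <= n, the order [n.+1 - i] is positive: the undifferentiated logarithm never occurs. *)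
rewrite subSn -1?ltnS// cderive1n_clogS//.
rewrite /cderive1n -/u -/v -(rmorph_nat (@real_complex R)).
by apply/eqP; rewrite eq_complex /=; apply/andP; split; apply/eqP; ring.
Qed.

End principal_logarithm.

(** * Comparison of moments *)

Section moment_recursion.
Context {R : realType} d (T : measurableType d) (P : probability T R).
Variable X : {RV P >-> R}.
Hypothesis X_moments : forall j : nat, ('E_P[fun w => (`|X w| ^+ j)%R] < +oo)%E.

Let m k : R := fine 'E_P[fun w => (X w ^+ k)%R].

Lemma moment0 : m 0 = 1.
Proof. by rewrite /m [X in expectation _ X](_ : _ = cst 1) ?expectation_cst. Qed.

Lemma expectation_exprn_fin k : 'E_P[fun w => (X w ^+ k)%R]%E = (m k)%:E.
Proof.
by rewrite /m fineK// unlock integrable_fin_num//; exact: integrable_exprn.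
Qed.

Lemma derivable_on_charfun n :
  derivable_on setT n (fun t => complex.Re (charfun P X t)) /\
  derivable_on setT n (fun t => complex.Im (charfun P X t)).
Proof.
have D f : (forall i (t : R), derivable (derive1n i f) t 1) -> derivable_on setT n f.
  elim: n f => //= n IH f df; split; first by move=> t _; exact: (df 0).
  by apply: IH => i t; rewrite -derive1Sn.
by split; apply: D => i t; have [] := derivable_charfun X_moments i t.
Qed.

Lemma moment_cumulant_recursion n :
  (m n.+1)%:C%C = \sum_(i < n.+1) 'C(n, i)%:R * (m i)%:C%C * cumulant P (n.+1 - i) X.
Proof.
(* On [U] the principal logarithm is smooth. [U] is open by continuity and contains 0, where the
   characteristic function is 1. *)
pose U := [set t | 0 < complex.Re (charfun P X t)].
have openU : open U.
  apply: (@open_comp _ _ (fun t => complex.Re (charfun P X t)) [set x | 0 < x]).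
    move=> t _; apply: differentiable_continuous; apply/derivable1_diffP.
    by have [/(_ t I)] := (derivable_on_charfun 1).1.
  exact: open_gt.
have U0 : U 0.
  by rewrite /U /mkset charfunE cos_moment_at0 -/(m 0) moment0.
have smooth k : derivable_on U k (fun t => complex.Re (charfun P X t)) /\
    derivable_on U k (fun t => complex.Im (charfun P X t)).
  have [DRe DIm] := derivable_on_charfun k.
  by split; exact: derivable_onS (@subsetT _ U) _.
have ii k : (- 'i%C) ^+ k * 'i%C ^+ k = 1 :> R[i].
  by rewrite -exprMn mulNr -expr2 sqr_i opprK expr1n.
have mE k : (m k)%:C%C = (- 'i%C) ^+ k * cderive1n k (charfun P X) 0.
  by rewrite cderive1n_charfun// cos_moment_at0 sin_moment_at0 mulrA ii mul1r.
have Re_gt0 t : U t -> 0 < complex.Re (charfun P X t) by [].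
rewrite mE (cderive1nS_clog openU smooth Re_gt0)// mulr_sumr; apply: eq_bigr => i _.
(* The power of -i splits between the moment of order i and the cumulant of order n + 1 - i. *)
have -> : (- 'i%C) ^+ n.+1 = (- 'i%C) ^+ i * (- 'i%C) ^+ (n.+1 - i) :> R[i].
  by rewrite -exprD subnKC// ltnW.
rewrite mE /cumulant -[fun t => clog _]/(clog \o charfun P X).
by ring.
Qed.

End moment_recursion.

Theorem corollary1p2 (R : realType)
  (d : nat -> measure_display) (T : forall n, measurableType (d n))
  (P : forall n, probability (T n) R)
  (Z : forall n, {RV (P n) >-> R})
  (Z_mean : forall n, ('E_(P n)[Z n] = 0)%E)
  (Z_var : forall n, ('V_(P n)[Z n] = 1)%E)
  (Z_moments : forall n j : nat,
     ('E_(P n)[fun w => (`|Z n w| ^+ j)%R] < +oo)%E)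
  (gamma : R) (gamma_ge0 : 0 <= gamma)
  (C : nat -> R) (C2 : C 2%N = 1)
  (Delta : nat -> R) (Delta_gt0 : forall n, 0 < Delta n)
  (cumulant_bound : forall n j : nat, (3 <= j)%N ->
     `|cumulant (P n) j (Z n)| <=
       ((j`!%:R `^ (1 + gamma) * C j) / Delta n ^+ (j - 2))%:C%C)
  (dN : measure_display) (TN : measurableType dN) (PN : probability TN R)
  (N : {RV PN >-> R})
  (N_normal : forall A : set (measurableTypeR R), measurable A ->
     distribution PN N A = normal_prob 0 1 A)
  (k : nat) (k_ge3 : (3 <= k)%N) (n : nat) :
  (`|'E_(P n)[fun w => (Z n w ^+ k)%R] - 'E_PN[fun w => (N w ^+ k)%R]| <=
     (k`!%:R `^ (1 + gamma) *
      \sum_(1 <= j < `|Num.ceil (k%:R / 2 - 1 : R)|.+1)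
        Atilde C j k * (1 / Delta n ^+ (k - 2 * j)))%:E)%E.
Proof.
pose m j : R := fine 'E_(P n)[fun w => (Z n w ^+ j)%R].
pose g j : R := fine 'E_PN[fun w => (N w ^+ j)%R].
pose c j := cumulant (P n) j (Z n).
have mrec : forall l, (m l.+1)%:C%C =
    \sum_(i < l.+1) 'C(l, i)%:R * (m i)%:C%C * c (l.+1 - i)%N.
  exact: moment_cumulant_recursion.
have m0 : (m 0)%:C%C = 1 by rewrite /m moment0 rmorph1.
have m1 : m 1 = 0 by rewrite /m; under eq_fun do rewrite expr1; rewrite Z_mean.
have m2 : m 2 = 1.
  have := Z_var n; rewrite /variance covariance.unlock Z_mean /m => V1.
  rewrite [X in expectation _ X](_ : _ =
    (Z n \- cst (fine 0%E)) * (Z n \- cst (fine 0%E))) ?V1//.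
  by apply/funext => w; rewrite !fctE /= subr0 expr2.
(* The first two cumulants are read off from the recursion at l = 0 and l = 1, given mean 0 and
   variance 1. *)
have c1 : c 1 = 0.
  by have := mrec 0; rewrite m1 big_ord1 bin0 !mul1r m0 mul1r subn0 => <-.
have c2 : c 2 = 1.
  have := mrec 1; rewrite m2 !big_ord_recl big_ord0 /= m0 bin0 m1 !mulr1 mul1r.
  by rewrite mulr0 mul0r !addr0 subn0 => <-.
(* Stein's identity in the form of the cumulant recursion: only the index i = l - 1 survives, with
   coefficient 'C(l, l - 1) = l, and for l = 0 both sides vanish. *)
have grec l : (g l.+1)%:C%C =
    \sum_(i < l.+1) 'C(l, i)%:R * (g i)%:C%C * (l.+1 - i == 2)%N%:R :> R[i].
  rewrite /g normal_momentS//.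
  case: l => [|l]; first by rewrite big_ord1 mul0r mulr0.
  rewrite (eq_bigr (fun i : 'I_l.+2 =>
      'C(l.+1, i)%:R * (g i)%:C%C * (i == l :> nat)%:R)); last first.
    by move=> i _; congr (_ * _%:R); have := ltn_ord i; lia.
  rewrite rmorphM rmorph_nat !big_ord_recr big1 /= ?add0r => [|i _].
    by rewrite binSn eqxx mulr1 (_ : (l.+1 == l) = false) ?mulr0 ?addr0//; lia.
  by rewrite ltn_eqF ?mulr0.
have g0 : (g 0)%:C%C = 1 by rewrite /g moment0 rmorph1.
have -> : 'E_PN[fun w => (N w ^+ k)%R]%E = (g k)%:E.
  by rewrite /g (expectation_exprn_normal N_normal).
rewrite expectation_exprn_fin// -/(m k) -EFinB /=.
rewrite lee_fin -lecR absz_ceil_half//.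
have -> : `|m k - g k|%:C%C = `|(m k)%:C%C - (g k)%:C%C| :> R[i].
  by rewrite -rmorphB normc_def /= expr0n addr0 sqrtr_sqr.
pose delta i : R[i] := (i == 2%N)%:R.
have -> := @moment_cumulantE _ (fun j => (m j)%:C%C) c m0 c1 mrec k.
have -> := @moment_cumulantE _ (fun j => (g j)%:C%C) delta g0 erefl grec k.
rewrite -sumrB -(big_mkord predT (fun j => cumulant_sum c j k - cumulant_sum delta j k)).
(* The cut is at the last j with 2j < k: beyond it the terms for Z and N cancel. *)
rewrite (@big_cat_nat _ _ _ k.-1./2.+1) //=; last by lia.
rewrite [X in _ + X]big1_seq ?addr0; last first.
  move=> j /andP[_]; rewrite mem_index_iota => /andP[kj _].
  by rewrite cumulant_sum_delta2 ?subrr//; lia.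
(* The term j = 0 drops out because the empty tuple has sum 0, not k. *)
rewrite big_ltn// !cumulant_sum0 ?subrr ?add0r; [|by lia..].
rewrite mulr_sumr rmorph_sum /=.
apply: le_trans (ler_norm_sum _ _ _) _.
apply: ler_sum_nat => j /andP[j1 jk].
rewrite [cumulant_sum delta _ _]cumulant_sum_delta2_eq0 ?subr0; last by lia.
by apply: norm_cumulant_sum_le => //; exact: cumulant_bound.
Qed.
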